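(* Assume that: (i) $Z_1,\dots,Z_p$ are independent stationary Gaussian processes on $\mathbb{R}^d$ with mean zero, unit variance and covariance functions $K_1,\dots,K_p$; (ii) there is a fixed $\Delta>0$ such that for all $n\in\mathbb{N}$ and all $i\neq j$ in $\{1,\dots,n\}$, $\|s_i-s_j\|\ge\Delta$; (iii) there are fixed $A>0$ and $\alpha>0$ such that $|K_k(x)|\le A/(1+\|x\|^{d+\alpha})$ for all $x\in\mathbb{R}^d$ and $k=1,\dots,p$; (iv) $f:\mathbb{R}^d\to\mathbb{R}$ satisfies, for the same $A$ and $\alpha$, $|f(x)|\le A/(1+\|x\|^{d+\alpha})$ for all $x\in\mathbb{R}^d$. Then $\widehat M(f)-M(f)\to 0$ in probability as $n\to\infty$.
   Context: $d,p\ge1$ are fixed integers. For each $n\in\mathbb{N}$, $s_1,\dots,s_n\in\mathcal S^d\subseteq\mathbb{R}^d$ are the $n$ observation points. $Z=(Z_1,\dots,Z_p)^\top$ is the latent field, and $X(s)=\Omega Z(s)$ is the observed field, with $\Omega$ a fixed invertible $p\times p$ matrix. $\|\cdot\|$ is the Euclidean norm. Define $$\widehat M(f)=n^{-1}\sum_{i=1}^n\sum_{j=1}^n f(s_i-s_j)X(s_i)X(s_j)^\top,\qquad M(f)=\mathrm{E}\{\widehat M(f)\}=n^{-1}\sum_{i=1}^n\sum_{j=1}^n f(s_i-s_j)\mathrm{E}\{X(s_i)X(s_j)^\top\}.$$ Both depend on $n$; $M(f)$ is not assumed to converge. *)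

(* Defs.v *)
From HB Require Import structures.
From mathcomp Require Import all_boot all_order all_algebra.
From mathcomp Require Import all_classical all_reals all_analysis.
Set Implicit Arguments.
Unset Strict Implicit.
Unset Printing Implicit Defensive.
Import Order.TTheory GRing.Theory Num.Theory.
Import numFieldNormedType.Exports.
Local Open Scope classical_set_scope.
Local Open Scope ring_scope.

(* The library norm on matrices is the sup norm, hence this definition. On
   column vectors it is the Euclidean norm, on matrices the Frobenius norm. *)
Definition enorm (R : realType) (m n : nat) (A : 'M[R]_(m, n)) : R :=
  Num.sqrt (\sum_i \sum_j A i j ^+ 2).

Section processes.
Context {d : measure_display} {T : measurableType d} {R : realType}.
Variable P : probability T R.

(* [normal_prob m 0] is a placeholder in the library (the uniform law on
   [0, 1]); the degenerate Gaussian law with zero variance is a point mass. *)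
Definition gaussian_law (m sigma : R) (B : set R) : \bar R :=
  if sigma == 0 then \d_m B else normal_prob m sigma B.

Definition gaussian_variable (Y : T -> R) : Prop :=
  exists m sigma : R, 0 <= sigma /\
    forall B : set R, measurable B -> P (Y @^-1` B) = gaussian_law m sigma B.

(* All finite-dimensional marginals are Gaussian vectors, i.e. all their linear
   combinations are (possibly degenerate) Gaussian variables. *)
Definition gaussian_process (E : Type) (X : E -> {RV P >-> R}) : Prop :=
  forall (n : nat) (x : 'I_n -> E) (a : 'I_n -> R),
    gaussian_variable (fun t => \sum_(i < n) a i * X (x i) t).

Definition stationary_process (V : zmodType) (X : V -> {RV P >-> R})
    (K : V -> R) : Prop :=
  (exists m : R, forall x, ('E_P[X x] = m%:E)%E) /\
  (forall x y, covariance P (X x) (X y) = (K (x - y))%:E).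

Definition process_sigma_algebra (E : Type) (X : E -> {RV P >-> R}) :
    set (set T) :=
  <<s \bigcup_x preimage_set_system setT (X x) measurable >>.

Definition independent_processes (I : finType) (E : Type)
    (X : I -> E -> {RV P >-> R}) : Prop :=
  forall (J : {set I}) (A : I -> set T),
    (forall k, k \in J -> process_sigma_algebra (X k) (A k)) ->
    P (\bigcap_(k in [set` J]) A k) = (\prod_(k in J) P (A k))%E.

Definition expectation_mx (m n : nat) (Y : T -> 'M[R]_(m, n)) : 'M[R]_(m, n) :=
  \matrix_(a, b) fine ('E_P[fun t => Y t a b])%E.

Definition cvg_in_probability (m n : nat) (Y : nat -> T -> 'M[R]_(m, n))
    (L : T -> 'M[R]_(m, n)) : Prop :=
  forall eps : R, 0 < eps ->
    P [set t | eps < enorm (Y k t - L t)] @[k --> \oo] --> 0%E.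

Definition mixed_field (E : Type) (p : nat) (Omega : 'M[R]_p)
    (Z : 'I_p -> E -> {RV P >-> R}) (x : E) (t : T) : 'cV[R]_p :=
  Omega *m \col_k Z k x t.

Definition Mhat (V : zmodType) (p : nat) (X : V -> T -> 'cV[R]_p)
    (n : nat) (s : 'I_n -> V) (f : V -> R) (t : T) : 'M[R]_p :=
  n%:R^-1 *:
    \sum_(i < n) \sum_(j < n) f (s i - s j) *: (X (s i) t *m (X (s j) t)^T).

Definition Mmean (V : zmodType) (p : nat) (X : V -> T -> 'cV[R]_p)
    (n : nat) (s : 'I_n -> V) (f : V -> R) : 'M[R]_p :=
  expectation_mx (Mhat X s f).

End processes.

(* Main.v *)
Require Import Defs.
From HB Require Import structures.
From mathcomp Require Import all_boot all_order all_algebra.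
From mathcomp Require Import all_classical all_reals all_analysis.
From mathcomp Require Import measurable_realfun ring lra.
Set Implicit Arguments.
Unset Strict Implicit.
Unset Printing Implicit Defensive.
Import Order.TTheory GRing.Theory Num.Theory.
Import numFieldNormedType.Exports.
Local Open Scope classical_set_scope.
Local Open Scope ring_scope.

(** Each entry of [Mhat - Mmean] is a linear combination, with coefficients
    taken from [Omega], of the centered latent statistics
    [n^-1 * \sum_(i, j) f (s_i - s_j) * (Z_k s_i * Z_l s_j - E (Z_k s_i * Z_l s_j))],
    one for each pair [(k, l)]. It is enough to show that each of these tends
    to 0 in mean square; Markov's inequality then gives convergence in
    probability.

    The mean square is [n^-2] times a sum over quadruples [(i, j, u, v)] of
    [f (s_i - s_j) * f (s_u - s_v)] times the covariance of [Z_k s_i * Z_l s_j]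
    and [Z_k s_u * Z_l s_v]. For [k = l] Isserlis' formula ([isserlis]) writes
    this covariance as a sum of two products of values of [K_k]; for [k <> l]
    independence leaves the single product
    [K_k (s_i - s_u) * K_l (s_j - s_v)]. With the common envelope
    [w x y = A / (1 + enorm (x - y) `^ (d + alpha))] of [f] and of the
    covariance functions, the covariance is at most [w_iu w_jv + w_iv w_ju] in
    both cases ([covariance_products_le]). Bounding the factor [f (s_u - s_v)]
    by the constant [A], three of the four summations cost only a row sum of
    [w] each and the last one costs [n]. Row sums of [w] are bounded uniformly
    in [n] since the points are separated ([separated_sum_bound]), so the whole
    sum is [O(n)] ([sum_four_kernel_le]) and the mean square is [O(1/n)]
    ([centered_latent_statistic_second_moment_le]).

    Isserlis' formula comes from the one-dimensional marginals: a centered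
    Gaussian variable [Y] satisfies [E Y^4 = 3 (E Y^2)^2], and applying this to
    the combinations [X x +- X y +- X z +- X w] and polarizing isolates
    [E (X x * X y * X z * X w)]. The normal moments themselves follow from the
    fact that the derivative of [(x - m)^k] times the density integrates
    to 0.

    For the row sums, space is cut into cubes so small that each contains at
    most one point. The envelope is dominated by a product over the coordinates
    of one-variable functions of the cube's integer position, and the sum of
    such a product over any finite set of cubes is at most the [d]-th power of
    a convergent series over the integers. *)

(** * Moments of normal laws *)

Section normal_moments.
Context {R : realType}.
Implicit Types m s x : R.
Local Notation mu := (@lebesgue_measure R).

(** With [u = (x - m)^2 / (8 s^2)] this is the inequality
    [u^2 <= (expR u)^2]: a factor [expR (- 2 u)], half of the exponent, absorbs
    the fourth power, and the other half is the exponent of a normal law of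
    twice the variance. *)
Lemma fourth_power_normal_fun_le m s x : s != 0 ->
  (x - m) ^+ 4 * normal_fun m s x <=
  64 * s ^+ 4 * normal_fun m (Num.sqrt 2 * s) x.
Proof.
move=> s0; rewrite /normal_fun exprMn sqr_sqrtr ?ler0n//.
set y := x - m; pose u := y ^+ 2 / (8 * s ^+ 2).
have s2 : 0 < s ^+ 2 by rewrite exprn_even_gt0.
have u0 : 0 <= u by rewrite divr_ge0 ?sqr_ge0// mulr_ge0// ltW.
have -> : - y ^+ 2 / (s ^+ 2 *+ 2) = - (2 * u) + - (2 * u).
  by rewrite /u -mulr_natr; field.
have -> : - y ^+ 2 / (2 * s ^+ 2 *+ 2) = - (2 * u).
  by rewrite /u -mulr_natr; field.
rewrite expRD mulrA ler_wpM2r ?expR_ge0//.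
rewrite expRN ler_pdivrMr ?expR_gt0//.
have -> : y ^+ 4 = 64 * s ^+ 4 * u ^+ 2 by rewrite /u; field.
rewrite ler_wpM2l//; first by rewrite mulr_ge0// -[4%N]/(2 * 2)%N exprM sqr_ge0.
rewrite (_ : 2 * u = u + u) ?expRD; last by ring.
by rewrite expr2 ler_pM// (le_trans _ (expR_ge1Dx _))// lerDr.
Qed.

(** Domination by another normal density gives both the integrability of the
    powers up to the fourth against the density and the decay at infinity of
    the functions whose derivatives are integrated below. *)
Lemma fourth_power_normal_pdf_le m s x : s != 0 ->
  (x - m) ^+ 4 * normal_pdf m s x <=
  64 * s ^+ 4 * Num.sqrt 2 * normal_pdf m (Num.sqrt 2 * s) x.
Proof.
move=> s0; have r0 : Num.sqrt 2 != 0 :> R by rewrite sqrtr_eq0 -ltNge.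
rewrite !normal_pdfE ?mulf_neq0//.
have -> : normal_peak (Num.sqrt 2 * s) = (Num.sqrt 2)^-1 * normal_peak s.
  rewrite /normal_peak exprMn sqr_sqrtr ?ler0n// -mulrA -mulrnAr sqrtrM//.
  by rewrite invfM.
rewrite (_ : _ * _ * Num.sqrt 2 * _ =
    normal_peak s * (64 * s ^+ 4 * normal_fun m (Num.sqrt 2 * s) x)); last first.
  by field.
by rewrite mulrCA ler_wpM2l ?normal_peak_ge0// fourth_power_normal_fun_le.
Qed.

Lemma measurable_power_normal_pdf m s k :
  measurable_fun setT (fun x => (x - m) ^+ k * normal_pdf m s x).
Proof.
apply: measurable_funM; last exact: measurable_normal_pdf.
by apply: measurable_funX; apply: measurable_funB.
Qed.

Lemma normr_expr_le4 (y : R) k : (k <= 4)%N -> `|y| ^+ k <= 1 + y ^+ 4.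
Proof.
move=> k4.
have y4 : y ^+ 4 = `|y| ^+ 4.
  by rewrite -[4%N]/(2 * 2)%N !exprM real_normK ?num_real.
rewrite y4; have [y1|y1] := leP `|y| 1.
  by rewrite (le_trans (exprn_ile1 _ (normr_ge0 y) y1))// lerDl exprn_ge0.
by rewrite (le_trans (ler_weXn2l (ltW y1) k4))// lerDr.
Qed.

Lemma integrable_power_normal_pdf m s k : s != 0 -> (k <= 4)%N ->
  mu.-integrable setT (EFin \o (fun x => (x - m) ^+ k * normal_pdf m s x)).
Proof.
move=> s0 k4.
apply: (@le_integrable _ _ _ mu setT measurableT _
  (EFin \o (normal_pdf m s \+
     (fun x => 64 * s ^+ 4 * Num.sqrt 2 * normal_pdf m (Num.sqrt 2 * s) x)))).
- by apply/measurable_EFinP; exact: measurable_power_normal_pdf.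
- move=> x _ /=; rewrite lee_fin normrM normrX (ger0_norm (normal_pdf_ge0 _ _ _)).
  rewrite [leRHS]ger0_norm; last first.
    apply: addr_ge0; first exact: normal_pdf_ge0.
    apply: mulr_ge0; last exact: normal_pdf_ge0.
    apply: mulr_ge0; last exact: sqrtr_ge0.
    by apply: mulr_ge0 => //; exact: exprn_even_ge0.
  rewrite (le_trans _ (lerD (lexx _) (fourth_power_normal_pdf_le _ _ s0)))//.
  rewrite -[X in _ <= X + _]mul1r -mulrDl ler_wpM2r ?normal_pdf_ge0//.
  exact: normr_expr_le4.
- rewrite (_ : EFin \o _ = (fun x => (normal_pdf m s x)%:E) \+
    (fun x => (64 * s ^+ 4 * Num.sqrt 2)%:E * (normal_pdf m (Num.sqrt 2 * s) x)%:E))%E//.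
  apply: integrableD => //; first exact: integrable_normal_pdf.
  by apply: integrableZl => //; exact: integrable_normal_pdf.
Qed.

Lemma is_derive_power_normal_pdf m s k x : s != 0 ->
  is_derive x 1 (fun x => (x - m) ^+ k * normal_pdf m s x)
    (k%:R * ((x - m) ^+ k.-1 * normal_pdf m s x)
     - s ^- 2 * ((x - m) ^+ k.+1 * normal_pdf m s x)).
Proof.
move=> s0; rewrite normal_pdfE//.
have dB : is_derive x 1 (fun x => x - m) (1 - 0).
  exact: (is_deriveB (is_derive_id x 1) (is_derive_cst m x 1)).
have dX j : is_derive x 1 (fun x => (x - m) ^+ j) (j%:R * (x - m) ^+ j.-1).
  rewrite (_ : (fun x => (x - m) ^+ j) = (fun x => x - m) ^+ j); last first.
    by apply/funext => y; rewrite fctE.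
  apply: is_derive_eq.
  by rewrite subr0 /GRing.scale/= mulr1.
have dg : is_derive x 1 (fun x : R => - (s ^+ 2 *+ 2)^-1 * (x - m) ^+ 2)
    (- (x - m) / s ^+ 2).
  have := is_deriveZ (- (s ^+ 2 *+ 2)^-1) (dX 2%N).
  by move=> /is_derive_eq; apply;
    rewrite /GRing.scale/= -mulr_natr; field.
have dE : is_derive x 1 (normal_fun m s)
    (normal_fun m s x * (- (x - m) / s ^+ 2)).
  rewrite (_ : normal_fun m s =
    expR \o (fun x => - (s ^+ 2 *+ 2)^-1 * (x - m) ^+ 2)); last first.
    by apply/funext => y; rewrite /normal_fun/= mulrC mulrN mulNr.
  exact: is_derive1_comp.
have := is_deriveM (dX k) (is_deriveZ (normal_peak s) dE).
move=> /is_derive_eq; apply.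
rewrite /GRing.scale/= (exprS _ k) -[_ *: _]/(normal_peak s * normal_fun m s x).
field.
by [].
Qed.

(** The fundamental theorem of calculus on the intervals
    [c - (n + 1), c + (n + 1)], passed to the limit by dominated
    convergence. *)
Lemma integral_derivative_sym (F F' : R -> R) (c l : R) :
  (forall x, is_derive x 1 F (F' x)) -> continuous F' ->
  mu.-integrable setT (EFin \o F') ->
  F (c + n.+1%:R) - F (c - n.+1%:R) @[n --> \oo] --> l ->
  (\int[mu]_x (F' x)%:E = l%:E)%E.
Proof.
move=> dF cF' iF' Fl.
have cF : continuous F.
  move=> x; apply/differentiable_continuous/derivable1_diffP.
  by have [] := dF x.
pose I n : set R := `[c - n.+1%:R, c + n.+1%:R]%classic.
pose f_ n := (EFin \o F') \_ (I n).
have f_lim x : f_ ^~ x @ \oo --> (F' x)%:E.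
  apply: cvg_near_cst; near=> n.
  rewrite /f_ patchE mem_set//= /I/= in_itv/= -ler_distlC.
  rewrite (@le_trans _ _ n%:R)// ?ler_nat//.
  by near: n; exact: nbhs_infty_ger.
have mF' : measurable_fun setT (EFin \o F') by exact: measurable_int iF'.
have mf_ n : measurable_fun setT (f_ n).
  have mI : measurable (I n) by exact: measurable_itv.
  by apply/(measurable_restrictT _ mI); apply: measurable_funTS; exact: mF'.
have f_le : {ae mu, forall x n, setT x -> (`|f_ n x| <= `|(F' x)%:E|)%E}.
  apply: aeW => x n _; rewrite /f_ patchE; case: ifPn => //= _.
  by rewrite normr0 lee_fin normr_ge0.
have f_lim_ae : {ae mu, forall x, setT x -> f_ ^~ x @ \oo --> (EFin \o F') x}.
  by apply: aeW => x _; exact: f_lim.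
have [_ _] := @dominated_convergence _ _ _ mu setT measurableT f_
  (EFin \o F') (abse \o (EFin \o F')) mf_ mF'
  f_lim_ae (integrable_abse iF') f_le.
move=> /= cv.
have fE : (fun n => \int[mu]_x f_ n x)%E =
    (fun n => (F (c + n.+1%:R) - F (c - n.+1%:R))%:E).
  apply/funext => n; rewrite /f_ -integral_mkcond/=.
  have ab : c - n.+1%:R < c + n.+1%:R by rewrite ltrD2l gtrN.
  rewrite (@continuous_FTC2 _ F' F)//.
  - exact: continuous_subspaceT.
  - split.
    + by move=> x _; have [] := dF x.
    + exact/cvg_at_right_filter/cF.
    + exact/cvg_at_left_filter/cF.
  - by move=> x _; rewrite derive1E; have [] := dF x.
rewrite fE in cv.
have cvl : (F (c + n.+1%:R) - F (c - n.+1%:R))%:E @[n --> \oo] --> l%:E.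
  by apply/fine_cvgP; split; [exact: nearW|exact: Fl].
exact: (cvg_unique _ cv cvl).
Unshelve. all: by end_near. Qed.

Lemma continuous_power_normal_pdf m s k : s != 0 ->
  continuous (fun x => (x - m) ^+ k * normal_pdf m s x).
Proof.
move=> s0 x; apply/differentiable_continuous/derivable1_diffP.
by have [] := is_derive_power_normal_pdf m k x s0.
Qed.

(** The integrand is the derivative of [(x - m)^k] times the density, which
    vanishes at both infinities: for [k <= 3] it is at most a constant
    divided by [`|x - m|]. *)
Lemma integral_power_normal_pdf_rec m s k : s != 0 -> (k <= 3)%N ->
  (\int[mu]_x (k%:R * ((x - m) ^+ k.-1 * normal_pdf m s x)
     - s ^- 2 * ((x - m) ^+ k.+1 * normal_pdf m s x))%:E = 0)%E.
Proof.
move=> s0 k3; apply: (@integral_derivative_sym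
  (fun x => (x - m) ^+ k * normal_pdf m s x) _ m 0).
- by move=> x; exact: is_derive_power_normal_pdf.
- move=> x; apply: cvgB; apply: cvgM; try exact: cvg_cst;
  exact: continuous_power_normal_pdf.
- rewrite (_ : EFin \o _ =
    (fun x => k%:R%:E * ((x - m) ^+ k.-1 * normal_pdf m s x)%:E) \-
    (fun x => (s ^- 2)%:E * ((x - m) ^+ k.+1 * normal_pdf m s x)%:E))%E//.
  apply: integrableB => //; apply: integrableZl => //.
    apply: integrable_power_normal_pdf => //.
    by rewrite (leq_trans (leq_pred _))// (leq_trans k3).
  exact: integrable_power_normal_pdf.
(* At distance [n + 1] from [m] the function is at most [C / (n + 1)]: one more
   factor [`|y - m|] turns the exponent [k] into [k + 1 <= 4]. *)
- pose C := 64 * s ^+ 4 * Num.sqrt 2 * normal_peak (Num.sqrt 2 * s).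
  have r0 : Num.sqrt 2 * s != 0 by rewrite mulf_neq0// sqrtr_eq0 -ltNge.
  have bnd (y : R) n : `|y - m| = n.+1%:R ->
      `|(y - m) ^+ k * normal_pdf m s y| <= C * n.+1%:R^-1.
    move=> yn; rewrite ler_pdivlMr// mulrC -yn normrM normrX mulrA -exprS.
    rewrite (ger0_norm (normal_pdf_ge0 _ _ _)).
    apply: le_trans (_ : (y - m) ^+ 4 * normal_pdf m s y <= _); last first.
      apply: (le_trans (fourth_power_normal_pdf_le _ _ s0)).
      rewrite ler_wpM2l ?normal_pdf_ub//.
      apply: mulr_ge0; last exact: sqrtr_ge0.
      by apply: mulr_ge0 => //; exact: exprn_even_ge0.
    rewrite ler_wpM2r ?normal_pdf_ge0//.
    rewrite -[leRHS]ger0_norm ?exprn_even_ge0// normrX yn.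
    by rewrite ler_weXn2l// ler1n.
  apply/norm_cvg0P; apply: (@squeeze_cvgr _ _ _ _ (cst 0)
    (fun n => (C *+ 2) * harmonic n)).
  + apply: nearW => n /=; rewrite normr_ge0/=.
    rewrite (le_trans (ler_normB _ _))// mulrnAl mulr2n lerD// bnd//.
      by rewrite addrAC subrr add0r normr_nat.
    by rewrite addrAC subrr add0r normrN normr_nat.
  + exact: cvg_cst.
  + by rewrite -[X in _ --> X](mulr0 (C *+ 2)); apply: cvgMr; exact: cvg_harmonic.
Qed.

(** The density is almost everywhere the Radon-Nikodym derivative, because both
    have the same integral over every measurable set. *)
Lemma ge0_integral_normal_prob (m s : R) (f : R -> \bar R) :
  measurable_fun setT f -> (forall x, 0 <= f x)%E ->
  (\int[normal_prob m s]_x f x = \int[mu]_x (f x * (normal_pdf m s x)%:E))%E.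
Proof.
move=> mf f0.
have dom := @normal_prob_dominates R m s.
rewrite -(Radon_Nikodym_SigmaFinite.change_of_variables dom)//.
have mpdf : measurable_fun setT (EFin \o normal_pdf m s).
  by apply/measurable_EFinP; exact: measurable_normal_pdf.
have ig := Radon_Nikodym_SigmaFinite.f_integrable dom.
apply: ae_eq_integral => //.
- by apply: emeasurable_funM => //; exact: measurable_int ig.
- exact: emeasurable_funM.
- apply: ae_eqe_mul2l; apply: integral_ae_eq => //=.
  by move=> E _ mE; rewrite -Radon_Nikodym_SigmaFinite.f_integral.
Qed.

Lemma integrable_normal_prob (m s : R) (f : R -> R) : measurable_fun setT f ->
  mu.-integrable setT (EFin \o (fun x => f x * normal_pdf m s x)) ->
  (normal_prob m s).-integrable setT (EFin \o f).
Proof.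
move=> mf /integrableP[_ fi]; apply/integrableP; split.
  exact/measurable_EFinP.
rewrite ge0_integral_normal_prob//; last first.
  by apply: measurableT_comp => //; exact/measurable_EFinP.
congr (_ < _)%E : fi; apply: eq_integral => x _ /=.
by rewrite normrM (ger0_norm (normal_pdf_ge0 _ _ _)).
Qed.

Lemma integral_normal_prob (m s : R) (f : R -> R) : measurable_fun setT f ->
  mu.-integrable setT (EFin \o (fun x => f x * normal_pdf m s x)) ->
  (\int[normal_prob m s]_x (f x)%:E = \int[mu]_x (f x * normal_pdf m s x)%:E)%E.
Proof.
move=> mf fi.
have mfE : measurable_fun setT (EFin \o f) by exact/measurable_EFinP.
rewrite integralE ge0_integral_normal_prob//; last exact: measurable_funepos.
rewrite [X in (_ - X)%E]ge0_integral_normal_prob//; last exact: measurable_funeneg.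
rewrite [RHS]integralE; congr (_ - _)%E; apply: eq_integral => x _.
  by rewrite !funeposE/= muleC maxeMr// ?lee_fin ?normal_pdf_ge0// mule0 EFinM muleC.
rewrite !funenegE/= muleC maxeMr// ?lee_fin ?normal_pdf_ge0// mule0.
by rewrite -EFinM mulrN mulrC.
Qed.

(** The recursion for central moments; [k = 0, 1, 3] give the values 0, [s^2]
    and [3 s^4] of the first, second and fourth ones. *)
Lemma Rintegral_power_normal_prob_rec (m s : R) k : s != 0 -> (k <= 3)%N ->
  \int[normal_prob m s]_x ((x - m) ^+ k.+1) =
  s ^+ 2 * k%:R * \int[normal_prob m s]_x ((x - m) ^+ k.-1).
Proof.
move=> s0 k3.
have mX j : measurable_fun setT (fun x : R => (x - m) ^+ j).
  by apply: measurable_funX; apply: measurable_funB.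
have k4 : (k.-1 <= 4)%N by rewrite (leq_trans (leq_pred _))// (leq_trans k3).
have i1 := integrable_power_normal_pdf m s0 k4.
have i2 := integrable_power_normal_pdf m s0 (k3 : (k.+1 <= 4)%N).
have := integral_power_normal_pdf_rec m s0 k3.
have -> : (\int[mu]_x (k%:R * ((x - m) ^+ k.-1 * normal_pdf m s x)
     - s ^- 2 * ((x - m) ^+ k.+1 * normal_pdf m s x))%:E)%E =
  (\int[mu]_x ((k%:R * ((x - m) ^+ k.-1 * normal_pdf m s x))%:E
     - (s ^- 2 * ((x - m) ^+ k.+1 * normal_pdf m s x))%:E))%E by [].
rewrite integralB//=; [|exact: (integrableZl _ (k%:R) i1)|
  exact: (integrableZl _ (s ^- 2) i2)].
under eq_integral do rewrite EFinM.
rewrite integralZl//.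
under [X in (_ - X)%E]eq_integral do rewrite EFinM.
rewrite integralZl//.
rewrite -!integral_normal_prob//.
rewrite -[X in (_ * X - _)%E]fineK; last first.
  by apply: integrable_fin_num => //; exact: integrable_normal_prob.
rewrite -[X in (_ - _ * X)%E]fineK; last first.
  by apply: integrable_fin_num => //; exact: integrable_normal_prob.
rewrite -!EFinM -EFinB => -[] /eqP; rewrite subr_eq0 => /eqP e.
by rewrite -mulrA e mulrA mulfV ?mul1r// expf_neq0.
Qed.
End normal_moments.

Section gaussian_variable_moments.
Context {d : measure_display} {T : measurableType d} {R : realType}.
Variable P : probability T R.

Lemma integral_of_law (nu : {measure set (measurableTypeR R) -> \bar R}) (Y : T -> R)
    (f : R -> R) :
  measurable_fun setT Y ->
  (forall B : set R, measurable B -> P (Y @^-1` B) = nu B) ->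
  measurable_fun setT f -> nu.-integrable setT (EFin \o f) ->
  P.-integrable setT (EFin \o (f \o Y)) /\
  \int[P]_t f (Y t) = \int[nu]_y f y.
Proof.
move=> mY YE mf fi.
pose Y' : {RV P >-> measurableTypeR R} := MeasurableFun.Pack
  (MeasurableFun.Class (isMeasurableFun.Build _ _ _ (measurableTypeR R) Y mY)).
have eq_law g : (\int[distribution P Y']_y g y = \int[nu]_y g y)%E.
  by apply: eq_measure_integral => A mA _; exact: YE.
have iP : P.-integrable setT (EFin \o (f \o Y)).
  apply/integrableP; split.
    by apply/measurable_EFinP; exact: measurableT_comp.
  have /integrableP[_] := fi.
  rewrite -eq_law (ge0_integral_distribution Y' (f := abse \o (EFin \o f)))//;
    last by move=> y; exact: abse_ge0.
  by apply: measurableT_comp => //; exact/measurable_EFinP.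
split=> //; rewrite /Rintegral -eq_law.
by rewrite (integral_distribution (X := Y'))//; exact/measurable_EFinP.
Qed.

Lemma integrable_dirac (m : R) (f : R -> R) : measurable_fun setT f ->
  (@dirac _ (measurableTypeR R) m R :
    {measure set (measurableTypeR R) -> \bar R}).-integrable setT (EFin \o f).
Proof.
move=> mf; apply/integrableP; split; first exact/measurable_EFinP.
rewrite integral_dirac//; last first.
  by apply: measurableT_comp => //; exact/measurable_EFinP.
by rewrite diracT mul1e ltry.
Qed.

(** For a nondegenerate law the first central moment is 0, so a centered
    variable has location parameter [m = 0] and its moments are the central
    moments of the law; a degenerate law is the point mass at 0. *)
Lemma gaussian_centered_moments (Y : T -> R) :
  measurable_fun setT Y -> gaussian_variable P Y -> ('E_P[Y] = 0)%E ->
  P.-integrable setT (EFin \o (fun t => Y t ^+ 4)) /\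
  \int[P]_t (Y t ^+ 4) = 3 * (\int[P]_t (Y t ^+ 2)) ^+ 2.
Proof.
move=> mY [m [s [s0]]] + EY.
have EY0 : \int[P]_t Y t = 0.
  by rewrite /Rintegral; move: EY; rewrite unlock => ->.
have mX k : measurable_fun setT (fun x : R => x ^+ k) by exact: measurable_funX.
rewrite /gaussian_law; case: eqVneq => [_|sn0] YE.
  have ax k := integral_of_law
    (nu := @dirac _ (measurableTypeR R) m R) mY YE (mX k) (integrable_dirac m (mX k)).
  have val k : \int[P]_t (Y t ^+ k) = m ^+ k.
    rewrite (ax k).2 /Rintegral integral_dirac//; last exact/measurable_EFinP.
    by rewrite diracT mul1e.
  split; first exact: (ax 4%N).1.
  rewrite !val; have := val 1%N; rewrite expr1.
  under eq_Rintegral do rewrite expr1.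
  by rewrite EY0 => <-; rewrite !expr0n/= mulr0.
have mXm k : measurable_fun setT (fun x : R => (x - m) ^+ k).
  by apply: measurable_funX; apply: measurable_funB.
have inu k : (k <= 4)%N ->
    (normal_prob m s).-integrable setT (EFin \o (fun x : R => (x - m) ^+ k)).
  by move=> k4; apply: integrable_normal_prob => //;
    exact: integrable_power_normal_pdf.
have ax k k4 := integral_of_law (nu := normal_prob m s) mY YE (mXm k) (inu k k4).
have rec k k3 := @Rintegral_power_normal_prob_rec R m s k sn0 k3.
(* A centered variable has [m = 0]: compare the first central moment, which is
   0, with the expectation of [Y - m]. *)
have m0 : m = 0.
  have [i1 e1] := ax 1%N isT.
  move: e1; rewrite (rec 0%N)// mulr0 mul0r => e1.
  have iY : P.-integrable setT (EFin \o Y).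
    rewrite (_ : _ \o Y = (EFin \o (fun t => (Y t - m) ^+ 1)%R) \+ cst m%:E)%E.
      by apply: integrableD => //; exact: finite_measure_integrable_cst.
    by apply/funext => t /=; rewrite -EFinD expr1 subrK.
  move: e1; under eq_Rintegral do rewrite expr1.
  rewrite RintegralB// ?EY0; last exact: finite_measure_integrable_cst.
  rewrite Rintegral_cst// [X in fine X](@probability_setT _ _ _ P)/= mulr1 sub0r => /eqP.
  by rewrite oppr_eq0 => /eqP.
have e k (k4 : (k <= 4)%N) :
    \int[P]_t (Y t ^+ k) = \int[normal_prob m s]_y ((y - m) ^+ k).
  by rewrite -(ax k k4).2; apply: eq_Rintegral => t _; rewrite /= m0 subr0.
split.
  by have := (ax 4%N isT).1; congr (integrable _ _ _); apply/funext => t /=;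
    rewrite m0 subr0.
rewrite !e// (rec 3%N)//= (rec 1%N)//=.
have -> : \int[normal_prob m s]_y ((y - m) ^+ 0) = 1.
  under eq_Rintegral do rewrite expr0.
  by rewrite Rintegral_cst// [X in fine X](@integral_normal_pdf R m s) mul1r.
by ring.
Qed.

End gaussian_variable_moments.

(** * Fourth-order moments of Gaussian processes *)

Section gaussian_product_moments.
Context {d : measure_display} {T : measurableType d} {R : realType}.
Variable P : probability T R.

Lemma Rintegral_linear_combination (I : Type) (r : seq I) (c : I -> R) (F : I -> T -> R) :
  (forall i, P.-integrable setT (EFin \o F i)) ->
  P.-integrable setT (EFin \o (fun t => \sum_(i <- r) c i * F i t)) /\
  \int[P]_t (\sum_(i <- r) c i * F i t) = \sum_(i <- r) c i * \int[P]_t F i t.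
Proof.
move=> iF; elim: r => [|i r [iS eS]].
  rewrite (_ : (fun t => \sum_(i <- [::]) c i * F i t) = cst 0); last first.
    by apply/funext => t; rewrite big_nil.
  split; first exact: finite_measure_integrable_cst.
  by rewrite big_nil Rintegral_cst// mul0r.
rewrite (_ : (fun t => \sum_(j <- i :: r) c j * F j t) =
    (fun t => c i * F i t) \+ (fun t => \sum_(j <- r) c j * F j t)); last first.
  by apply/funext => t; rewrite big_cons.
have iZ : P.-integrable setT (EFin \o (fun t => c i * F i t)).
  exact: (integrableZl _ (c i) (iF i)).
split; first exact: (integrableD _ iZ iS).
by rewrite big_cons RintegralD// RintegralZl// eS.
Qed.

(** The integrability class used throughout: it contains the constants and the
    values of a centered Gaussian process, and products of up to four of its members are
    integrable. *)
Definition finite_fourth_moment (Y : T -> R) : Prop :=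
  measurable_fun setT Y /\ P.-integrable setT (EFin \o (fun t => Y t ^+ 4)).

Lemma finite_fourth_moment_cst c : finite_fourth_moment (fun=> c).
Proof. by split=> //; exact: finite_measure_integrable_cst. Qed.

(** The inequality [`|x * y| <= x^2 + y^2], used for [x = a * b], [y = c * e]
    and then for the squares of [a, b] and of [c, e]. *)
Lemma normr_prod4_le (a b c e : R) :
  `|a * b * c * e| <= a ^+ 4 + b ^+ 4 + c ^+ 4 + e ^+ 4.
Proof.
have AG (x y : R) : `|x * y| <= x ^+ 2 + y ^+ 2.
  by rewrite ler_norml; apply/andP; split; nra.
have AG4 (x y : R) : (x * y) ^+ 2 <= x ^+ 4 + y ^+ 4.
  by rewrite (le_trans (ler_norm _))// exprMn (le_trans (AG _ _))// -!exprM.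
rewrite -[a * b * c * e]mulrA (le_trans (AG _ _))// -addrA.
by rewrite lerD// AG4.
Qed.

Lemma integrable_prod4 (Y1 Y2 Y3 Y4 : T -> R) :
  finite_fourth_moment Y1 -> finite_fourth_moment Y2 ->
  finite_fourth_moment Y3 -> finite_fourth_moment Y4 ->
  P.-integrable setT (EFin \o (fun t => Y1 t * Y2 t * Y3 t * Y4 t)).
Proof.
move=> [m1 i1] [m2 i2] [m3 i3] [m4 i4].
apply: (@le_integrable _ _ _ P setT measurableT _
  (EFin \o (fun t => Y1 t ^+ 4 + Y2 t ^+ 4 + Y3 t ^+ 4 + Y4 t ^+ 4))).
- by apply/measurable_EFinP; do 3 (apply: measurable_funM => //).
- move=> t _ /=; rewrite lee_fin.
  by rewrite (le_trans (normr_prod4_le _ _ _ _))// ler_norm.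
- exact: (integrableD _ (integrableD _ (integrableD _ i1 i2) i3) i4).
Qed.

Lemma integrable_prod2 (Y1 Y2 : T -> R) :
  finite_fourth_moment Y1 -> finite_fourth_moment Y2 ->
  P.-integrable setT (EFin \o (fun t => Y1 t * Y2 t)).
Proof.
move=> f1 f2.
have := integrable_prod4 f1 f2 (finite_fourth_moment_cst 1) (finite_fourth_moment_cst 1).
by congr (integrable _ _ _); apply/funext => t /=; rewrite !mulr1.
Qed.

Lemma integrable_finite_fourth_moment (Y : T -> R) :
  finite_fourth_moment Y -> P.-integrable setT (EFin \o Y).
Proof.
move=> f1; have := integrable_prod2 f1 (finite_fourth_moment_cst 1).
by congr (integrable _ _ _); apply/funext => t /=; rewrite !mulr1.
Qed.

Section gaussian.
Variables (E : Type) (X : E -> {RV P >-> R}).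
Hypotheses (gX : gaussian_process X) (X0 : forall x, ('E_P[X x] = 0)%E).

Lemma gaussian_process_finite_fourth_moment x : finite_fourth_moment (X x).
Proof.
split=> //; apply: (gaussian_centered_moments _ _ (X0 x)).1 => //.
have := gX (fun _ : 'I_1 => x) (fun=> 1).
by congr gaussian_variable; apply/funext => t; rewrite big_ord1 mul1r.
Qed.
Local Hint Resolve gaussian_process_finite_fourth_moment : core.

(** A linear combination of values of the process is again a centered Gaussian
    variable, so its fourth moment is determined by the covariances. *)
Lemma gaussian_fourth_moment (n : nat) (x : 'I_n -> E) (a : 'I_n -> R) :
  P.-integrable setT (EFin \o (fun t => (\sum_(i < n) a i * X (x i) t) ^+ 4)) /\
  \int[P]_t ((\sum_(i < n) a i * X (x i) t) ^+ 4) =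
  3 * (\sum_(i < n) \sum_(j < n) a i * a j * \int[P]_t (X (x i) t * X (x j) t)) ^+ 2.
Proof.
have i1 y : P.-integrable setT (EFin \o X y).
  exact: integrable_finite_fourth_moment.
have [iS eS] := Rintegral_linear_combination (index_enum 'I_n) a (fun i => i1 (x i)).
have mS : measurable_fun setT (fun t => \sum_(i < n) a i * X (x i) t).
  by apply/measurable_EFinP; exact: measurable_int iS.
have ES : ('E_P[(fun t => \sum_(i < n) a i * X (x i) t)%R] = 0)%E.
  rewrite unlock -[LHS]fineK; last exact: integrable_fin_num.
  move: eS; rewrite /Rintegral => ->; rewrite big1// => i _.
  by have := X0 (x i); rewrite unlock => ->; rewrite mulr0.
have [i4 ->] := gaussian_centered_moments mS (gX x a) ES.
split=> //; congr (3 * _ ^+ 2).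
have i2 (p : 'I_n * 'I_n) :
    P.-integrable setT (EFin \o (fun t => X (x p.1) t * X (x p.2) t)).
  exact: integrable_prod2.
have [_] := Rintegral_linear_combination (index_enum ('I_n * 'I_n)%type)
  (fun p => a p.1 * a p.2) i2.
rewrite -(pair_bigA _ (fun i j => a i * a j * \int[P]_t (X (x i) t * X (x j) t)))/=.
move=> <-; apply: eq_Rintegral => t _.
rewrite -(pair_bigA _ (fun i j => a i * a j * (X (x i) t * X (x j) t)))/=.
rewrite expr2 big_distrlr/=; apply: eq_bigr => i _; apply: eq_bigr => j _.
by ring.
Qed.

(** In the expansion of a fourth power, the alternating sum over the eight
    choices of signs kills every monomial except [x * y * z * w], which has
    coefficient 24, up to the sign, in each power; hence [192 = 8 * 24]. *)
Lemma polarization4 (x y z w : R) (F := fun e : R * R * R =>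
    (x + e.1.1 * y + e.1.2 * z + e.2 * w) ^+ 4) :
  \sum_(e <- [:: (1, 1, 1); (1, 1, -1); (1, -1, 1); (1, -1, -1);
                 (-1, 1, 1); (-1, 1, -1); (-1, -1, 1); (-1, -1, -1)])
    (e.1.1 * e.1.2 * e.2) * F e = 192 * (x * y * z * w).
Proof. by rewrite /F !big_cons big_nil/=; ring. Qed.

(** Polarization reduces the mixed moment to fourth moments of the combinations
    [X x +- X y +- X z +- X w]; these are known, and the same alternating sum
    applied to the squared quadratic forms leaves the three pairings. *)
Lemma isserlis (x y z w : E) (C := fun u v => \int[P]_t (X u t * X v t)) :
  \int[P]_t (X x t * X y t * X z t * X w t) =
  C x y * C z w + C x z * C y w + C x w * C y z.
Proof.
(* The default values of [nth] are never reached. *)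
pose pt (i : 'I_4) := nth x [:: x; y; z; w] i.
pose co (e : R * R * R) (i : 'I_4) : R := nth 0 [:: 1; e.1.1; e.1.2; e.2] i.
have SE e t : \sum_(i < 4) co e i * X (pt i) t =
    X x t + e.1.1 * X y t + e.1.2 * X z t + e.2 * X w t.
  by rewrite !big_ord_recl big_ord0 /co /pt/=; ring.
have Csym u v : C u v = C v u by apply: eq_Rintegral => t _; rewrite mulrC.
have iF e : P.-integrable setT (EFin \o (fun t =>
    (X x t + e.1.1 * X y t + e.1.2 * X z t + e.2 * X w t) ^+ 4)).
  have [+ _] := gaussian_fourth_moment pt (co e).
  by congr (integrable _ _ _); apply/funext => t /=; rewrite SE.
have m4 e : \int[P]_t ((X x t + e.1.1 * X y t + e.1.2 * X z t + e.2 * X w t) ^+ 4) =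
    3 * (C x x + e.1.1 ^+ 2 * C y y + e.1.2 ^+ 2 * C z z + e.2 ^+ 2 * C w w
     + 2 * (e.1.1 * C x y + e.1.2 * C x z + e.2 * C x w
     + e.1.1 * e.1.2 * C y z + e.1.1 * e.2 * C y w + e.1.2 * e.2 * C z w)) ^+ 2.
  have [_ +] := gaussian_fourth_moment pt (co e).
  under eq_Rintegral do rewrite SE.
  move=> ->; congr (3 * _ ^+ 2).
  rewrite !big_ord_recl !big_ord0 /co /pt/= -!/(C _ _).
  rewrite (Csym y x) (Csym z x) (Csym w x) (Csym z y) (Csym w y) (Csym w z).
  by ring.
apply: (@mulfI _ 192) => //.
rewrite -RintegralZl//; last exact: integrable_prod4.
under eq_Rintegral do rewrite -polarization4.
rewrite (Rintegral_linear_combination _ _ iF).2.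
under eq_bigr do rewrite m4.
by rewrite !big_cons big_nil/=; ring.
Qed.

End gaussian.
End gaussian_product_moments.

(** * Products of independent variables *)

Section independence.
Context {d : measure_display} {T : measurableType d} {R : realType}.
Variable P : probability T R.

(** The joint law agrees with the product of the marginal laws on rectangles,
    hence everywhere, and the expectation of the product is computed by
    Fubini's theorem. *)
Lemma Rintegral_mul_independent (U V : T -> R) :
  measurable_fun setT U -> measurable_fun setT V ->
  (forall A B : set R, measurable A -> measurable B ->
     P (U @^-1` A `&` V @^-1` B) = (P (U @^-1` A) * P (V @^-1` B))%E) ->
  P.-integrable setT (EFin \o U) -> P.-integrable setT (EFin \o V) ->
  P.-integrable setT (EFin \o (fun t => U t * V t)) ->
  \int[P]_t (U t * V t) = \int[P]_t U t * \int[P]_t V t.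
Proof.
move=> mU mV ind iU iV iUV.
pose U' : {RV P >-> R} := MeasurableFun.Pack
  (MeasurableFun.Class (isMeasurableFun.Build _ _ _ _ U mU)).
pose V' : {RV P >-> R} := MeasurableFun.Pack
  (MeasurableFun.Class (isMeasurableFun.Build _ _ _ _ V mV)).
have mW : measurable_fun setT (fun t => (U t, V t)) by exact: measurable_fun_pair.
pose W : {RV P >-> (R * R)%type} := MeasurableFun.Pack
  (MeasurableFun.Class (isMeasurableFun.Build _ _ _ _ _ mW)).
have lawW (g : R * R -> \bar R) :
    (\int[(distribution P U' \x distribution P V')%E]_z g z
     = \int[distribution P W]_z g z)%E.
  apply: eq_measure_integral => A mA _.
  by apply: product_measure_unique => // B C mB mC; exact: ind.
pose f (z : R * R) : \bar R := (z.1 * z.2)%:E.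
have mf : measurable_fun setT f.
  by apply/measurable_EFinP; apply: measurable_funM;
    [exact: measurable_fst|exact: measurable_snd].
have if_ : (distribution P U' \x distribution P V')%E.-integrable setT f.
  apply/integrableP; split => //.
  rewrite lawW (ge0_integral_distribution W (f := abse \o f))//.
  - by have /integrableP[_] := iUV.
  - exact: measurableT_comp.
  - by move=> z; exact: abse_ge0.
have EU : (\int[distribution P U']_x x%:E = (\int[P]_t U t)%:E)%E.
  rewrite (integral_distribution (X := U') (f := EFin))//.
  by rewrite /Rintegral fineK// integrable_fin_num.
have EV : (\int[distribution P V']_x x%:E = (\int[P]_t V t)%:E)%E.
  rewrite (integral_distribution (X := V') (f := EFin))//.
  by rewrite /Rintegral fineK// integrable_fin_num.
have iV' : (distribution P V').-integrable setT (EFin : R -> \bar R).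
  apply/integrableP; split=> //.
  rewrite (ge0_integral_distribution V' (f := abse \o EFin))//.
  - by have /integrableP[_] := iV.
  - exact: measurableT_comp.
  - by move=> z; exact: abse_ge0.
have iU' : (distribution P U').-integrable setT (EFin : R -> \bar R).
  apply/integrableP; split=> //.
  rewrite (ge0_integral_distribution U' (f := abse \o EFin))//.
  - by have /integrableP[_] := iU.
  - exact: measurableT_comp.
  - by move=> z; exact: abse_ge0.
rewrite {1}/Rintegral -(integral_distribution (X := W) (f := f))//.
rewrite -lawW -(integral12_prod_meas1 if_)/fubini_F/f/=.
under eq_integral => x _.
  under eq_integral do rewrite EFinM.
  rewrite integralZl// EV muleC.
  over.
by rewrite integralZl// EU -EFinM/= mulrC.
Qed.

Section processes.
Variables (I : finType) (E : Type) (Z : I -> E -> {RV P >-> R}).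

Lemma independent_processes_pair k l (A B : set T) :
  independent_processes Z -> k != l ->
  process_sigma_algebra (Z k) A -> process_sigma_algebra (Z l) B ->
  P (A `&` B) = (P A * P B)%E.
Proof.
move=> indZ kl sA sB.
have := indZ [set k; l]%SET (fun i => if i == k then A else B).
rewrite big_setU1/=; last by rewrite inE.
rewrite big_set1 eqxx [l == k]eq_sym (negbTE kl) => <-.
  congr (P _); apply/seteqP; split => t.
    move=> [At Bt] i /=; rewrite !inE => /orP[|] /eqP ->.
      by rewrite eqxx.
    by rewrite eq_sym (negbTE kl).
  move=> h; split.
    by have := h k; rewrite /= eqxx; apply; rewrite !inE eqxx.
  by have := h l; rewrite /= eq_sym (negbTE kl); apply; rewrite !inE eqxx orbT.
move=> i; rewrite !inE => /orP[|] /eqP ->; first by rewrite eqxx.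
by rewrite eq_sym (negbTE kl).
Qed.

(** Both factors are measurable functions on [T] equipped with the
    sigma-algebra of the process, hence so is their product. *)
Lemma process_sigma_algebra_mul k x y (A : set R) : measurable A ->
  process_sigma_algebra (Z k) ((fun t => Z k x t * Z k y t) @^-1` A).
Proof.
move=> mA.
pose G : set (set T) := \bigcup_x preimage_set_system setT (Z k x) measurable.
have mZ z : measurable_fun (setT : set (g_sigma_algebraType G)) (Z k z : _ -> R).
  move=> _ B mB; apply: sub_sigma_algebra; exists z => //; exists B => //.
have := @measurable_funM _ (g_sigma_algebraType G) R setT _ _ (mZ x) (mZ y).
by move=> /(_ measurableT A mA); rewrite setTI.
Qed.

Lemma process_sigma_algebra_preimage k x (A : set R) : measurable A ->
  process_sigma_algebra (Z k) (Z k x @^-1` A).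
Proof.
move=> mA; apply: sub_sigma_algebra; exists x => //.
by exists A => //; rewrite setTI.
Qed.

End processes.
End independence.

(** * Sums over separated points *)

Section separated_points.
Context {R : realType}.

(** The terms of the series [\sum (m + 1)^-(1 + b)] are dominated by the
    differences of a telescoping sequence. This is the tangent inequality
    [expR x >= 1 + x] at [x = b * ln ((t + 1) / t)], together with
    [ln ((t + 1) / t) >= 1 / (t + 1)]. *)
Lemma powRN_succ_diff_ge (b t : R) : 0 < b -> 0 < t ->
  b * ((t + 1) `^ (1 + b))^-1 <= t `^ (- b) - (t + 1) `^ (- b).
Proof.
move=> b0 t0; have t1 : 0 < t + 1 by rewrite addr_gt0.
have t1n : t + 1 != 0 by rewrite gt_eqF.
rewrite powRD; last by rewrite t1n implybT.
rewrite powRr1 ?(ltW t1)// invfM -powRN lerBrDr mulrA -[X in _ + X]mul1r -mulrDl.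
have -> : t `^ (- b) = expR (b * (ln (t + 1) - ln t)) * (t + 1) `^ (- b).
  rewrite /powR gt_eqF// gt_eqF// -expRD; congr expR; ring.
rewrite ler_wpM2r ?powR_ge0// (le_trans _ (expR_ge1Dx _))// addrC lerD2l.
rewrite ler_wpM2l ?(ltW b0)//.
have -> : ln t = ln (t + 1) + ln (1 + - (t + 1)^-1).
  rewrite -lnM ?posrE//; last by rewrite subr_gt0 invf_lt1// ltrDr.
  by congr ln; field.
rewrite opprD addrA subrr add0r lerNr; apply: le_ln1Dx.
by rewrite ltrN2 invf_lt1// ltrDr.
Qed.

Lemma sum_inv_powR_le (b : R) N : 0 < b ->
  \sum_(m < N) (m.+1%:R `^ (1 + b))^-1 <= 1 + b^-1.
Proof.
move=> b0; case: N => [|N].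
  by rewrite big_ord0 addr_ge0// invr_ge0 ltW.
apply: (@le_trans _ _ (1 + b^-1 * (1 - N.+1%:R `^ (- b)))); last first.
  by rewrite lerD2l ler_piMr ?invr_ge0 ?(ltW b0)// gerBl powR_ge0.
elim: N => [|N IH].
  by rewrite big_ord1/= !mulr1n !powR1 invr1 subrr mulr0 addr0.
rewrite big_ord_recr/= (le_trans (lerD IH (lexx _)))//.
rewrite -addrA lerD2l -lerBrDl -mulrBr ler_pdivlMl//.
have := @powRN_succ_diff_ge b N.+1%:R b0 (ltr0Sn _ _).
rewrite natr1 => /le_trans; apply; rewrite le_eqVlt; apply/orP; left; apply/eqP.
by move: (_ `^ _) (_ `^ _) => p q; ring.
Qed.

(** Distinct integer points of a box: the sum is at most the sum over the whole
    box, which factorizes coordinate by coordinate into [d] equal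
    one-dimensional sums. The factor 2 accounts for the sign of each
    coordinate. *)
Lemma sum_separable_le (d n : nat) (g : nat -> R) (B : R)
    (z : 'I_n -> 'I_d -> int) :
  (forall m, 0 <= g m) -> (forall N, \sum_(m < N) g m <= B) ->
  (forall i j, (forall c, z i c = z j c) -> i = j) ->
  \sum_(i < n) \prod_(c < d) g `|z i c|%N <= (B *+ 2) ^+ d.
Proof.
move=> g0 gB zinj.
(* A box large enough to contain all the points; the bound must not depend
   on it. *)
pose N := \max_(i < n) \max_(c < d) `|z i c|%N.
have zN i c : (`|z i c| < N.+1)%N.
  rewrite ltnS (leq_trans (leq_bigmax (F := fun c => `|z i c|%N) c))//.
  exact: (leq_bigmax (F := fun i => \max_(c < d) `|z i c|%N) i).
(* An integer is encoded by its sign and its absolute value. *)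
pose phi i : {ffun 'I_d -> bool * 'I_N.+1} :=
  [ffun c => ((z i c < 0), Ordinal (zN i c))].
have phi_inj : injective phi.
  move=> i j ij; apply: zinj => c.
  have := congr1 (fun f : {ffun 'I_d -> bool * 'I_N.+1} => f c) ij.
  rewrite !ffunE => -[sg ab].
  by rewrite [LHS]intEsign [RHS]intEsign sg ab.
pose G (f : {ffun 'I_d -> bool * 'I_N.+1}) := \prod_(c < d) g (f c).2.
have -> : \sum_(i < n) \prod_(c < d) g `|z i c|%N = \sum_(i < n) G (phi i).
  by apply: eq_bigr => i _; apply: eq_bigr => c _; rewrite ffunE.
have -> : \sum_(i < n) G (phi i) = \sum_(f in phi @: 'I_n) G f.
  by rewrite big_imset//= => i j _ _; exact: phi_inj.
apply: (@le_trans _ _ (\sum_f G f)).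
  rewrite [leRHS](bigID (mem (phi @: 'I_n)))/= lerDl.
  by apply: sumr_ge0 => f _; apply: prodr_ge0 => c _.
rewrite /G -(bigA_distr_bigA (fun (c : 'I_d) (u : bool * 'I_N.+1) => g u.2)).
rewrite prodr_const card_ord lerXn2r ?nnegrE//.
- by apply: sumr_ge0 => u _; exact: g0.
- by rewrite mulrn_wge0// (le_trans _ (gB 0%N))// big_ord0.
rewrite -(pair_bigA _ (fun (_ : bool) (m : 'I_N.+1) => g m))/= big_bool/=.
by rewrite mulr2n lerD ?gB.
Qed.

Lemma normr_le_enorm (d : nat) (y : 'cV[R]_d) c : `|y c 0| <= enorm y.
Proof.
rewrite -[leLHS]sqrtr_sqr ler_wsqrtr//.
rewrite (bigD1 c)//= (bigD1 0)//= -addrA lerDl addr_ge0//.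
  by apply: sumr_ge0 => j _; exact: sqr_ge0.
by apply: sumr_ge0 => i _; apply: sumr_ge0 => j _; exact: sqr_ge0.
Qed.

(** The cube of side [D / (d + 1)] has diameter less than [D]. The divisor
    [d + 1] makes the comparison strict for every [d], 0 included. *)
Lemma enorm_lt (d : nat) (y : 'cV[R]_d) (D : R) : 0 < D ->
  (forall c, `|y c 0| < D / d.+1%:R) -> enorm y < D.
Proof.
move=> D0 yD; rewrite -[ltRHS]ger0_norm ?ltW// -sqrtr_sqr ltr_sqrt ?exprn_gt0//.
apply: (@le_lt_trans _ _ (\sum_(c < d) (D / d.+1%:R) ^+ 2)).
  apply: ler_sum => c _; rewrite big_ord1 -real_normK ?num_real//.
  by rewrite lerXn2r ?nnegrE ?divr_ge0 ?(ltW D0)// ltW.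
rewrite sumr_const card_ord -[_ *+ d]mulr_natr exprMn -mulrA gtr_pMr ?exprn_gt0//.
rewrite exprVn mulrC ltr_pdivrMr ?exprn_gt0// mul1r -natrX ltr_nat.
by rewrite -mulnn mulSn ltn_addr.
Qed.

(** Every coordinate of the cube containing [y] is, in absolute value and
    increased by 1, at most [c0 * (1 + enorm y)], so the product of the [d] one-dimensional factors,
    each with exponent [gam / d], is at most [(c0 * (1 + enorm y)) `^ gam]; and
    [(1 + t) `^ gam <= 2 `^ gam * (1 + t `^ gam)]. The point of the bound is
    that the isotropic decay is replaced by a product over the coordinates. *)
Lemma inv1D_powR_le (d : nat) (h gam : R) (y : 'cV[R]_d) :
  (0 < d)%N -> 0 < h -> 0 < gam ->
  (1 + enorm y `^ gam)^-1 <=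
  (2 * (2 + h^-1)) `^ gam *
  \prod_(c < d) (`|Num.floor (y c 0 / h)%R|%N.+1%:R `^ (gam / d%:R))^-1.
Proof.
move=> d0 h0 gam0; set t := enorm y.
have t0 : 0 <= t by exact: sqrtr_ge0.
have gam_ge0 := ltW gam0.
have hV : 0 < h^-1 by rewrite invr_gt0.
set c0 := 2 + h^-1; have c00 : 0 <= c0 by rewrite addr_ge0// ltW.
have fl c : `|Num.floor (y c 0 / h)%R|%N.+1%:R <= c0 * (1 + t).
  have yt := normr_le_enorm y c.
  rewrite -natr1 natr_absz intr_norm.
  have f1 := floor_le_tmp (y c 0 / h).
  have f2 := lt_succ_floor (y c 0 / h).
  rewrite intrD in f2.
  have : `|(Num.floor (y c 0 / h))%:~R| <= `|y c 0 / h| + 1 :> R.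
    rewrite ler_norml; have := ler_norm (y c 0 / h).
    have := ler_norm (- (y c 0 / h)); rewrite normrN => *.
    by apply/andP; split; lra.
  rewrite normrM (ger0_norm (ltW hV)) => k1.
  have k2 : `|y c 0| * h^-1 <= t * h^-1 by rewrite ler_wpM2r// ltW.
  rewrite /c0 mulrDl !mulrDr; have := ltW hV; nra.
have P0 : 0 < \prod_(c < d) `|Num.floor (y c 0 / h)%R|%N.+1%:R `^ (gam / d%:R) :> R.
  by apply: prodr_gt0 => c _; rewrite powR_gt0.
set Q := \prod_(c < d) _ in P0.
have pw (x z r : R) : 0 <= r -> 0 <= x -> x <= z -> x `^ r <= z `^ r.
  by move=> r0 x0 xz; apply: (ge0_ler_powR r0); rewrite ?nnegrE// (le_trans x0).
have QM : Q <= (c0 * (1 + t)) `^ gam.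
  rewrite (_ : gam = gam / d%:R * d%:R); last by rewrite divfK// pnatr_eq0 -lt0n.
  rewrite powRrM powR_mulrn ?powR_ge0//.
  rewrite (_ : _ ^+ d = \prod_(c < d) (c0 * (1 + t)) `^ (gam / d%:R)); last first.
    by rewrite prodr_const card_ord.
  apply: ler_prod => c _; rewrite powR_ge0/=.
  by rewrite pw// divr_ge0.
have tM : (1 + t) `^ gam <= 2 `^ gam * (1 + t `^ gam).
  have [t1|t1] := leP t 1.
    apply: (@le_trans _ _ (2 `^ gam)).
      by rewrite pw// ?addr_ge0//; lra.
    by rewrite ler_peMr ?powR_ge0// lerDl powR_ge0.
  apply: (@le_trans _ _ ((2 * t) `^ gam)).
    by rewrite pw// ?addr_ge0//; lra.
  by rewrite powRM// ler_wpM2l ?powR_ge0// lerDr.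
rewrite prodfV -[leRHS]invrK lef_pV2 ?posrE; last 2 first.
- by rewrite ltr_pwDl// powR_ge0.
- by rewrite invr_gt0 mulr_gt0 ?invr_gt0// powR_gt0// mulr_gt0// ltr_pwDl// ltW.
rewrite invfM invrK mulrC ler_pdivrMr; last first.
  by rewrite powR_gt0// mulr_gt0// ltr_pwDl// ltW.
apply: (le_trans QM); rewrite (powRM _ c00) ?addr_ge0// (@powRM _ 2 c0)//.
rewrite mulrC mulrA [_ * 2 `^ gam]mulrC.
by rewrite ler_wpM2r ?powR_ge0.
Qed.

(** With cubes of side [Delta / (d + 1)] the map sending a point to its cube is
    injective, and each one-dimensional factor decays with exponent
    [gam / d = 1 + b / d > 1], hence is summable. *)
Lemma separated_sum_bound (d : nat) (Delta gam b : R) :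
  (0 < d)%N -> 0 < Delta -> 0 < b -> gam = d%:R + b ->
  exists C : R, forall (n : nat) (s : 'I_n -> 'cV[R]_d),
    (forall i j, i != j -> Delta <= enorm (s i - s j)) ->
    forall x, \sum_(j < n) (1 + enorm (x - s j) `^ gam)^-1 <= C.
Proof.
move=> d0 D0 b0 gamE.
have dR0 : 0 < d%:R :> R by rewrite ltr0n.
have gam0 : 0 < gam by rewrite gamE addr_gt0.
pose h := Delta / d.+1%:R; have h0 : 0 < h by rewrite divr_gt0.
pose g (m : nat) : R := (m.+1%:R `^ (gam / d%:R))^-1.
pose c := (2 * (2 + h^-1)) `^ gam.
exists (c * ((1 + (b / d%:R)^-1) *+ 2) ^+ d) => n s sep x.
pose z i k := Num.floor ((x - s i) k 0 / h).
apply: (@le_trans _ _ (\sum_(j < n) c * \prod_(k < d) g `|z j k|%N)).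
  by apply: ler_sum => j _; exact: inv1D_powR_le.
rewrite -mulr_sumr ler_wpM2l ?powR_ge0//; apply: sum_separable_le.
- by move=> m; rewrite invr_ge0 powR_ge0.
- move=> N; have := @sum_inv_powR_le (b / d%:R) N (divr_gt0 b0 dR0).
  rewrite (_ : 1 + b / d%:R = gam / d%:R)//.
  by rewrite gamE mulrDl divff// gt_eqF.
- move=> i j zij; apply/eqP; apply: contraT => /sep; rewrite leNgt => /negP[].
  apply: enorm_lt => // k.
  have f1 := floor_le_tmp ((x - s i) k 0 / h).
  have f2 := lt_succ_floor ((x - s i) k 0 / h).
  have f3 := floor_le_tmp ((x - s j) k 0 / h).
  have f4 := lt_succ_floor ((x - s j) k 0 / h).
  have := zij k; rewrite /z => e; rewrite e in f1 f2.
  rewrite intrD in f2 f4; rewrite -/h -[ltRHS]mul1r -ltr_pdivrMr//.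
  rewrite -[X in _ / X]gtr0_norm// -normf_div ltr_norml.
  have -> : (s i - s j) k 0 / h = (x - s j) k 0 / h - (x - s i) k 0 / h.
    by rewrite !mxE; field; rewrite gt_eqF.
  by apply/andP; split; lra.
Qed.

End separated_points.

(** * Bounds on finite sums *)

Section finite_sums.
Context {R : realType}.

(** One factor [w g.1 g.2] is bounded by [A]. The sum over [g] of the remaining
    products splits into two row sums, the sum over [e.2] is a third one, and
    only the sum over [e.1] contributes a factor [n]. *)
Lemma sum_four_kernel_le (n : nat) (A C : R) (w : 'I_n -> 'I_n -> R) :
  0 <= A -> (forall i j, 0 <= w i j <= A) -> (forall i, \sum_j w i j <= C) ->
  \sum_(e : 'I_n * 'I_n) \sum_(g : 'I_n * 'I_n) w e.1 e.2 * w g.1 g.2 *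
    (w e.1 g.1 * w e.2 g.2 + w e.1 g.2 * w e.2 g.1) <= n%:R * (2 * A * C ^+ 3).
Proof.
move=> A0 wA wC.
have w0 i j : 0 <= w i j by have /andP[] := wA i j.
have r0 i : 0 <= \sum_j w i j by apply: sumr_ge0.
have inner e : \sum_(g : 'I_n * 'I_n)
    (w e.1 g.1 * w e.2 g.2 + w e.1 g.2 * w e.2 g.1) <= 2 * C ^+ 2 :> R.
  rewrite big_split/= mulr_natl mulr2n lerD//.
    rewrite -(pair_bigA _ (fun u v => w e.1 u * w e.2 v))/= -big_distrlr/=.
    by rewrite expr2 ler_pM.
  rewrite -(pair_bigA _ (fun u v => w e.1 v * w e.2 u))/= exchange_big/=.
  by rewrite -big_distrlr/= expr2 ler_pM.
pose S (e g : 'I_n * 'I_n) := w e.1 g.1 * w e.2 g.2 + w e.1 g.2 * w e.2 g.1.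
have S0 e g : 0 <= S e g by rewrite addr_ge0// mulr_ge0.
apply: (@le_trans _ _ (\sum_(e : 'I_n * 'I_n) w e.1 e.2 * (A * (2 * C ^+ 2)))).
  apply: ler_sum => e _.
  apply: (@le_trans _ _ (\sum_g w e.1 e.2 * (A * S e g))).
    apply: ler_sum => g _; rewrite -mulrA ler_wpM2l// ler_wpM2r ?S0//.
    by have /andP[] := wA g.1 g.2.
  by rewrite -!mulr_sumr ler_wpM2l// ler_wpM2l// inner.
rewrite -mulr_suml -(pair_bigA _ (fun i j => w i j))/=.
have -> : n%:R * (2 * A * C ^+ 3) = (\sum_(i < n) C) * (A * (2 * C ^+ 2)).
  by rewrite sumr_const card_ord -mulr_natl; ring.
apply: ler_wpM2r; last exact: ler_sum.
by apply: mulr_ge0 => //; apply: mulr_ge0 => //; exact: sqr_ge0.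
Qed.

(** The Cauchy-Schwarz inequality against the constant family 1, from
    [2 * x_i * x_j <= x_i^2 + x_j^2]. *)
Lemma sqr_sum_le (I : finType) (x : I -> R) :
  (\sum_i x i) ^+ 2 <= #|I|%:R * \sum_i x i ^+ 2.
Proof.
rewrite expr2 big_distrlr/= -(ler_pM2l (ltr0n _ 2)).
apply: (@le_trans _ _ (\sum_i \sum_j (x i ^+ 2 + x j ^+ 2))).
  rewrite mulr_sumr; apply: ler_sum => i _; rewrite mulr_sumr.
  apply: ler_sum => j _; rewrite -subr_ge0.
  by rewrite (_ : _ - _ = (x i - x j) ^+ 2) ?sqr_ge0//; ring.
rewrite (eq_bigr (fun i => \sum_(j : I) x i ^+ 2 + \sum_(j : I) x j ^+ 2)); last first.
  by move=> i _; rewrite big_split.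
rewrite big_split/= [X in X + _]exchange_big/= !sumr_const -[_ *+ _]mulr_natl.
by rewrite le_eqVlt; apply/orP; left; apply/eqP; ring.
Qed.
End finite_sums.

(** * Covariances of products of the latent processes *)

Section products_of_fields.
Context {d : measure_display} {T : measurableType d} {R : realType}.
Variable P : probability T R.

Lemma second_moment_centered_combination (I : finType) (c : I -> R) (Q : I -> T -> R) :
  (forall p, P.-integrable setT (EFin \o Q p)) ->
  (forall p q, P.-integrable setT (EFin \o (fun t => Q p t * Q q t))) ->
  let Y t := \sum_p c p * (Q p t - \int[P]_t Q p t) in
  P.-integrable setT (EFin \o (fun t => Y t ^+ 2)) /\
  \int[P]_t (Y t ^+ 2) = \sum_p \sum_q c p * c q *
    (\int[P]_t (Q p t * Q q t) - (\int[P]_t Q p t) * (\int[P]_t Q q t)).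
Proof.
move=> iQ iQQ Y.
pose m p := \int[P]_t Q p t.
pose F (e : I * I) t :=
  Q e.1 t * Q e.2 t - m e.1 * Q e.2 t - m e.2 * Q e.1 t + m e.1 * m e.2.
have ic (r : R) : P.-integrable setT (EFin \o cst r).
  exact: finite_measure_integrable_cst.
have iZ r q : P.-integrable setT (EFin \o (fun t => r * Q q t)).
  exact: (integrableZl _ r (iQ q)).
have iB1 e : P.-integrable setT (EFin \o (fun t => Q e.1 t * Q e.2 t - m e.1 * Q e.2 t)).
  exact: (integrableB _ (iQQ e.1 e.2) (iZ (m e.1) e.2)).
have iB2 e : P.-integrable setT
    (EFin \o (fun t => Q e.1 t * Q e.2 t - m e.1 * Q e.2 t - m e.2 * Q e.1 t)).
  exact: (integrableB _ (iB1 e) (iZ (m e.2) e.1)).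
have iF e : P.-integrable setT (EFin \o F e).
  exact: (integrableD _ (iB2 e) (ic (m e.1 * m e.2))).
have EF e : \int[P]_t F e t = \int[P]_t (Q e.1 t * Q e.2 t) - m e.1 * m e.2.
  rewrite /F RintegralD//; last exact: ic.
  rewrite RintegralB// RintegralB// RintegralZl// RintegralZl// Rintegral_cst//.
  rewrite [X in fine X](@probability_setT _ _ _ P)/= -!/(m _).
  by ring.
have YF t : Y t ^+ 2 = \sum_(e : I * I) (c e.1 * c e.2) * F e t.
  rewrite -(pair_bigA _ (fun p q => c p * c q * F (p, q) t))/= expr2 /Y big_distrlr/=.
  by apply: eq_bigr => p _; apply: eq_bigr => q _; rewrite /F/= -!/(m _); ring.
have -> : (fun t => Y t ^+ 2) = (fun t => \sum_(e : I * I) (c e.1 * c e.2) * F e t).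
  by apply/funext.
have [iS ->] := Rintegral_linear_combination (index_enum (I * I)%type)
  (fun e => c e.1 * c e.2) iF.
split=> //.
rewrite -(pair_bigA _ (fun p q => c p * c q * \int[P]_t F (p, q) t))/=.
by apply: eq_bigr => p _; apply: eq_bigr => q _; rewrite EF.
Qed.

Lemma markov_Rintegral (V : T -> R) (e : R) : 0 < e ->
  (forall t, 0 <= V t) -> P.-integrable setT (EFin \o V) ->
  (P [set t | (e <= V t)%R] <= (e^-1 * \int[P]_t V t)%:E)%E.
Proof.
move=> e0 V0 iV.
have mV : measurable_fun setT V by apply/measurable_EFinP; exact: measurable_int iV.
pose V' : {RV P >-> R} := MeasurableFun.Pack
  (MeasurableFun.Class (isMeasurableFun.Build _ _ _ _ V mV)).
have := @markov _ _ _ P V' id e e0 (@measurable_id _ _ _)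
  (fun _ => id) (fun _ _ _ _ => id).
have -> : [set x | (e%:E <= `|(V' x)%:E|)%E] = [set t | e <= V t].
  by apply/seteqP; split => t; rewrite /= lee_fin ger0_norm.
have -> : ('E_P[id \o (fun x => `|x|%R) \o V'] = (\int[P]_t V t)%:E)%E.
  rewrite unlock /Rintegral fineK; last exact: integrable_fin_num.
  by apply: eq_integral => t _; rewrite /= ger0_norm.
by rewrite EFinM lee_pdivlMl.
Qed.

Section field.
Variables (V : zmodType) (p : nat) (Z : 'I_p -> V -> {RV P >-> R}).
Variables (K : 'I_p -> V -> R).
Hypothesis hindep : independent_processes Z.
Hypothesis hgauss : forall k : 'I_p, gaussian_process (Z k).
Hypothesis hstat : forall k : 'I_p, stationary_process (Z k) (K k).
Hypothesis hmean : forall (k : 'I_p) x, ('E_P[Z k x] = 0)%E.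

Lemma field_finite_fourth_moment k x : finite_fourth_moment P (Z k x).
Proof. exact: gaussian_process_finite_fourth_moment. Qed.
Local Hint Resolve field_finite_fourth_moment : core.

Lemma Rintegral_field_mul k x y : \int[P]_t (Z k x t * Z k y t) = K k (x - y).
Proof.
have [_ /(_ x y)] := hstat k.
rewrite unlock !hmean/= unlock /Rintegral => e.
rewrite -[RHS]/(fine (K k (x - y))%:E) -e; congr fine.
apply: eq_integral => t _.
by transitivity (((Z k x t - 0) * (Z k y t - 0))%:E); first rewrite !subr0.
Qed.

Lemma Rintegral_field_cross k l x y : k != l ->
  \int[P]_t (Z k x t * Z l y t) = 0.
Proof.
move=> kl; rewrite Rintegral_mul_independent//.
- have -> : \int[P]_t Z k x t = 0.
    by rewrite /Rintegral; have := hmean k x; rewrite unlock => ->.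
  by rewrite mul0r.
- move=> A B mA mB; apply: (independent_processes_pair hindep kl);
  exact: process_sigma_algebra_preimage.
- exact: integrable_finite_fourth_moment.
- exact: integrable_finite_fourth_moment.
- exact: integrable_prod2.
Qed.

(** For [k = l] the product of the means is the first of the three pairings in
    Isserlis' formula, and the other two remain. For [k <> l] regrouping the
    factors by process gives one pairing; the mean of [Z k x * Z l y] is 0. The
    bound is the same in both cases. *)
Lemma covariance_products_le (W : V -> V -> R) k l x y u v :
  (forall a b, 0 <= W a b) -> (forall k a b, `|K k (a - b)| <= W a b) ->
  `|\int[P]_t ((Z k x t * Z l y t) * (Z k u t * Z l v t)) -
    \int[P]_t (Z k x t * Z l y t) * \int[P]_t (Z k u t * Z l v t)|
  <= W x u * W y v + W x v * W y u.
Proof.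
move=> W0 KW; have [->|kl] := eqVneq l k.
  have -> : \int[P]_t ((Z k x t * Z k y t) * (Z k u t * Z k v t)) =
      \int[P]_t (Z k x t * Z k y t * Z k u t * Z k v t).
    by apply: eq_Rintegral => t _; rewrite mulrA.
  rewrite (isserlis (hgauss k) (hmean k))/=.
  have cancel (a b c : R) : a + b + c - a = b + c by ring.
  rewrite cancel.
  rewrite !Rintegral_field_mul (le_trans (ler_normD _ _))// !normrM.
  by rewrite lerD// ler_pM.
rewrite eq_sym in kl.
rewrite (Rintegral_field_cross x y kl) mul0r subr0.
have -> : \int[P]_t ((Z k x t * Z l y t) * (Z k u t * Z l v t)) =
    \int[P]_t ((Z k x t * Z k u t) * (Z l y t * Z l v t)).
  by apply: eq_Rintegral => t _; ring.
rewrite Rintegral_mul_independent.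
- rewrite !Rintegral_field_mul normrM.
  by rewrite (@le_trans _ _ (W x u * W y v)) ?ler_pM// lerDl mulr_ge0.
- exact: measurable_funM.
- exact: measurable_funM.
- move=> A B mA mB; apply: (independent_processes_pair hindep kl);
  exact: process_sigma_algebra_mul.
- exact: integrable_prod2.
- exact: integrable_prod2.
- have := integrable_prod4 (field_finite_fourth_moment k x)
    (field_finite_fourth_moment k u) (field_finite_fourth_moment l y)
    (field_finite_fourth_moment l v).
  by congr (integrable _ _ _); apply/funext => t /=; rewrite mulrA.
Qed.

End field.
End products_of_fields.

(** * Mean square deviation of the empirical matrix *)

Section mean_square_bound.
Context {d : measure_display} {T : measurableType d} {R : realType}.
Variable P : probability T R.
Variables (V : zmodType) (p : nat) (Z : 'I_p -> V -> {RV P >-> R}).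
Variables (K : 'I_p -> V -> R) (f : V -> R).
Hypothesis hindep : independent_processes Z.
Hypothesis hgauss : forall k : 'I_p, gaussian_process (Z k).
Hypothesis hstat : forall k : 'I_p, stationary_process (Z k) (K k).
Hypothesis hmean : forall (k : 'I_p) x, ('E_P[Z k x] = 0)%E.

Local Notation ff4 := (field_finite_fourth_moment hgauss hmean).

(** The [(k, l)] entry of the empirical matrix that would be obtained from the
    latent field itself, that is, for [Omega = 1]. *)
Definition latent_statistic (n : nat) (s : 'I_n -> V)
    (kl : 'I_p * 'I_p) (t : T) : R :=
  \sum_(e : 'I_n * 'I_n) n%:R^-1 * f (s e.1 - s e.2) *
     (Z kl.1 (s e.1) t * Z kl.2 (s e.2) t).

Definition centered_latent_statistic (n : nat) (s : 'I_n -> V)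
    (kl : 'I_p * 'I_p) (t : T) : R :=
  \sum_(e : 'I_n * 'I_n) n%:R^-1 * f (s e.1 - s e.2) *
     (Z kl.1 (s e.1) t * Z kl.2 (s e.2) t -
      \int[P]_t (Z kl.1 (s e.1) t * Z kl.2 (s e.2) t)).

Lemma centered_latent_statisticE n (s : 'I_n -> V) kl t :
  centered_latent_statistic s kl t =
  latent_statistic s kl t - \int[P]_t latent_statistic s kl t.
Proof.
have iQ (e : 'I_n * 'I_n) : P.-integrable setT
    (EFin \o (fun t => Z kl.1 (s e.1) t * Z kl.2 (s e.2) t)).
  by apply: integrable_prod2; exact: ff4.
have [_ ->] := Rintegral_linear_combination (index_enum ('I_n * 'I_n)%type)
  (fun e => n%:R^-1 * f (s e.1 - s e.2)) iQ.
by rewrite -sumrB; apply: eq_bigr => e _; rewrite mulrBr.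
Qed.

Lemma integrable_latent_statistic n (s : 'I_n -> V) kl :
  P.-integrable setT (EFin \o latent_statistic s kl).
Proof.
have iQ (e : 'I_n * 'I_n) : P.-integrable setT
    (EFin \o (fun t => Z kl.1 (s e.1) t * Z kl.2 (s e.2) t)).
  by apply: integrable_prod2; exact: ff4.
exact: (Rintegral_linear_combination (index_enum ('I_n * 'I_n)%type)
  (fun e => n%:R^-1 * f (s e.1 - s e.2)) iQ).1.
Qed.

Lemma centered_latent_statistic_second_moment n (s : 'I_n -> V) kl :
  P.-integrable setT (EFin \o (fun t => centered_latent_statistic s kl t ^+ 2)) /\
  \int[P]_t (centered_latent_statistic s kl t ^+ 2) =
  \sum_(e : 'I_n * 'I_n) \sum_(g : 'I_n * 'I_n)
    (n%:R^-1 * f (s e.1 - s e.2)) * (n%:R^-1 * f (s g.1 - s g.2)) *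
    (\int[P]_t ((Z kl.1 (s e.1) t * Z kl.2 (s e.2) t) *
       (Z kl.1 (s g.1) t * Z kl.2 (s g.2) t)) -
     \int[P]_t (Z kl.1 (s e.1) t * Z kl.2 (s e.2) t) *
     \int[P]_t (Z kl.1 (s g.1) t * Z kl.2 (s g.2) t)).
Proof.
apply: (second_moment_centered_combination
  (fun e : 'I_n * 'I_n => n%:R^-1 * f (s e.1 - s e.2))
  (Q := fun e t => Z kl.1 (s e.1) t * Z kl.2 (s e.2) t)).
- by move=> e; apply: integrable_prod2; exact: ff4.
- move=> e g.
  have := integrable_prod4 (ff4 kl.1 (s e.1)) (ff4 kl.2 (s e.2))
    (ff4 kl.1 (s g.1)) (ff4 kl.2 (s g.2)).
  by congr (integrable _ _ _); apply/funext => t /=; rewrite !mulrA.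
Qed.

(** The [O(1/n)] rate: [n^-2] from the normalization times the [O(n)] bound of
    [sum_four_kernel_le]. *)
Lemma centered_latent_statistic_second_moment_le n (s : 'I_n -> V) kl
    (W : V -> V -> R) (A C : R) :
  0 <= A -> (forall a b, 0 <= W a b <= A) ->
  (forall k a b, `|K k (a - b)| <= W a b) ->
  (forall a b, `|f (a - b)| <= W a b) ->
  (forall i, \sum_(j < n) W (s i) (s j) <= C) ->
  \int[P]_t (centered_latent_statistic s kl t ^+ 2) <= 2 * A * C ^+ 3 * n%:R^-1.
Proof.
move=> A0 WA KW fW WC.
have W0 a b : 0 <= W a b by have /andP[] := WA a b.
rewrite (centered_latent_statistic_second_moment s kl).2.
pose w (i j : 'I_n) := W (s i) (s j).
apply: (@le_trans _ _ (n%:R ^- 2 *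
  \sum_(e : 'I_n * 'I_n) \sum_(g : 'I_n * 'I_n) w e.1 e.2 * w g.1 g.2 *
    (w e.1 g.1 * w e.2 g.2 + w e.1 g.2 * w e.2 g.1))).
  rewrite mulr_sumr; apply: ler_sum => e _; rewrite mulr_sumr.
  apply: ler_sum => g _; rewrite (le_trans (ler_norm _))// !normrM.
  rewrite normfV normr_nat -exprVn.
  rewrite (_ : _ * _ * _ = n%:R^-1 ^+ 2 * (`|f (s e.1 - s e.2)| * `|f (s g.1 - s g.2)| *
     `|\int[P]_t ((Z kl.1 (s e.1) t * Z kl.2 (s e.2) t) *
       (Z kl.1 (s g.1) t * Z kl.2 (s g.2) t)) -
     \int[P]_t (Z kl.1 (s e.1) t * Z kl.2 (s e.2) t) *
     \int[P]_t (Z kl.1 (s g.1) t * Z kl.2 (s g.2) t)|)); last by ring.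
  rewrite ler_wpM2l ?exprn_ge0 ?invr_ge0// ler_pM// ?mulr_ge0//.
    by rewrite ler_pM.
  exact: (covariance_products_le hindep hgauss hstat hmean).
(* For [n = 0] both sides vanish, as [0^-1 = 0]. *)
case: n s WC @w => [|n] s WC w; first by rewrite invr0 expr0n/= invr0 mul0r mulr0.
rewrite ler_pdivrMl ?exprn_gt0// (le_trans (sum_four_kernel_le A0 _ WC))//.
rewrite le_eqVlt; apply/orP; left; apply/eqP; field.
by rewrite addrC natr1 pnatr_eq0.
Qed.

Variable Omega : 'M[R]_p.
Local Notation X := (mixed_field Omega Z).

(** [Mhat] is the latent empirical matrix multiplied by [Omega] on the left and
    by its transpose on the right. *)
Lemma MhatE n (s : 'I_n -> V) t a b :
  Mhat X s f t a b =
  \sum_(kl : 'I_p * 'I_p) Omega a kl.1 * Omega b kl.2 * latent_statistic s kl t.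
Proof.
rewrite /Mhat mxE summxE.
rewrite -(pair_bigA _ (fun k l => Omega a k * Omega b l * latent_statistic s (k, l) t))/=.
under eq_bigr do rewrite summxE.
transitivity (\sum_(i < n) \sum_(j < n) \sum_(k < p) \sum_(l < p)
   Omega a k * Omega b l * (n%:R^-1 * f (s i - s j) * (Z k (s i) t * Z l (s j) t))).
  rewrite mulr_sumr; apply: eq_bigr => i _; rewrite mulr_sumr.
  apply: eq_bigr => j _; rewrite !mxE big_ord1 !mxE big_distrlr/= mulr_sumr mulr_sumr.
  apply: eq_bigr => k _; rewrite mulr_sumr mulr_sumr; apply: eq_bigr => l _.
  by rewrite !mxE; ring.
rewrite pair_bigA/= exchange_big/=; apply: eq_bigr => k _.
rewrite exchange_big/=; apply: eq_bigr => l _.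
by rewrite /latent_statistic mulr_sumr.
Qed.

Lemma Mhat_sub_MmeanE n (s : 'I_n -> V) t a b :
  (Mhat X s f t - Mmean P X s f) a b =
  \sum_(kl : 'I_p * 'I_p) Omega a kl.1 * Omega b kl.2 *
     centered_latent_statistic s kl t.
Proof.
rewrite mxE [X in _ + X]mxE /Mmean /expectation_mx [X in - X]mxE unlock MhatE.
rewrite -/(Rintegral P setT (fun t => Mhat X s f t a b)).
under eq_Rintegral do rewrite MhatE.
have [_ ->] := Rintegral_linear_combination (index_enum ('I_p * 'I_p)%type)
  (fun kl => Omega a kl.1 * Omega b kl.2) (integrable_latent_statistic s).
rewrite -sumrB; apply: eq_bigr => kl _.
by rewrite centered_latent_statisticE mulrBr.
Qed.

Lemma sqr_enorm (m q : nat) (B : 'M[R]_(m, q)) :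
  enorm B ^+ 2 = \sum_i \sum_j B i j ^+ 2.
Proof.
rewrite sqr_sqrtr//; apply: sumr_ge0 => i _; apply: sumr_ge0 => j _.
exact: sqr_ge0.
Qed.

(** The Cauchy-Schwarz inequality, applied in each entry [(a, b)] to the sum over
    the pairs [(k, l)], compares the squared Frobenius norm of [Mhat - Mmean]
    with that of its latent counterpart up to this factor. *)
Definition mixing_constant : R :=
  \sum_a \sum_b #|{: 'I_p * 'I_p}|%:R *
     \sum_(kl : 'I_p * 'I_p) (Omega a kl.1 * Omega b kl.2) ^+ 2.

Lemma sqr_enorm_Mhat_sub_Mmean_le n (s : 'I_n -> V) t :
  enorm (Mhat X s f t - Mmean P X s f) ^+ 2 <=
  mixing_constant * \sum_kl centered_latent_statistic s kl t ^+ 2.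
Proof.
rewrite sqr_enorm /mixing_constant mulr_suml; apply: ler_sum => a _.
rewrite mulr_suml; apply: ler_sum => b _.
rewrite Mhat_sub_MmeanE (le_trans (sqr_sum_le _))// -mulrA ler_wpM2l//.
rewrite mulr_suml; apply: ler_sum => kl _; rewrite exprMn ler_wpM2l ?sqr_ge0//.
by rewrite (bigD1 kl)//= lerDl sumr_ge0// => ? _; exact: sqr_ge0.
Qed.

Lemma Mhat_deviation_le n (s : 'I_n -> V) (W : V -> V -> R) (A C eps : R) :
  0 <= A -> (forall a b, 0 <= W a b <= A) ->
  (forall k a b, `|K k (a - b)| <= W a b) ->
  (forall a b, `|f (a - b)| <= W a b) ->
  (forall i, \sum_(j < n) W (s i) (s j) <= C) -> 0 < eps ->
  (P [set t | (eps < enorm (Mhat X s f t - Mmean P X s f))%R] <=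
   ((eps ^+ 2)^-1 * (mixing_constant *
     (#|{: 'I_p * 'I_p}|%:R * (2 * A * C ^+ 3))) * n%:R^-1)%:E)%E.
Proof.
move=> A0 WA KW fW WC eps0.
pose D t := enorm (Mhat X s f t - Mmean P X s f) ^+ 2.
pose G t := mixing_constant * \sum_kl centered_latent_statistic s kl t ^+ 2.
have M0 : 0 <= mixing_constant.
  apply: sumr_ge0 => a _; apply: sumr_ge0 => b _; apply: mulr_ge0 => //.
  by apply: sumr_ge0 => kl _; exact: sqr_ge0.
have iG2 kl := (centered_latent_statistic_second_moment s kl).1.
have [iG eG] := Rintegral_linear_combination (index_enum ('I_p * 'I_p)%type)
  (fun=> mixing_constant) iG2.
have GE : (fun t => \sum_kl mixing_constant * centered_latent_statistic s kl t ^+ 2) = G.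
  by apply/funext => t; rewrite /G mulr_sumr.
rewrite GE in iG eG.
have G0 t : 0 <= G t.
  by apply: mulr_ge0 => //; apply: sumr_ge0 => kl _; exact: sqr_ge0.
have mG : measurable_fun setT G by apply/measurable_EFinP; exact: measurable_int iG.
have mC kl : measurable_fun setT (centered_latent_statistic s kl).
  rewrite (_ : centered_latent_statistic s kl =
    latent_statistic s kl \- cst (\int[P]_t latent_statistic s kl t)); last first.
    by apply/funext => t; rewrite centered_latent_statisticE.
  apply: measurable_funB => //; apply/measurable_EFinP.
  exact: measurable_int (integrable_latent_statistic s kl).
have mD : measurable_fun setT D.
  rewrite (_ : D = fun t => \sum_a \sum_b (\sum_(kl : 'I_p * 'I_p)
      Omega a kl.1 * Omega b kl.2 * centered_latent_statistic s kl t) ^+ 2).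
    apply: measurable_sum => a; apply: measurable_sum => b.
    apply: measurable_funX; apply: measurable_sum => kl.
    exact: measurable_funM.
  apply/funext => t; rewrite /D sqr_enorm.
  by apply: eq_bigr => a _; apply: eq_bigr => b _; rewrite Mhat_sub_MmeanE.
have e20 : 0 < eps ^+ 2 by rewrite exprn_gt0.
have -> : [set t | eps < enorm (Mhat X s f t - Mmean P X s f)] =
    [set t | eps ^+ 2 < D t].
  by apply/seteqP; split=> t /=;
    rewrite /D ltr_pXn2r// ?nnegrE ?sqrtr_ge0// ltW.
have le1 : (P [set t | (eps ^+ 2 < D t)%R] <= P [set t | (eps ^+ 2 <= G t)%R])%E.
  apply: le_measure; rewrite ?inE.
  - have := mD measurableT _ (measurable_itv `]eps ^+ 2, +oo[).
    by rewrite setTI; congr measurable; apply/seteqP; split=> t /=; rewrite in_itv/= andbT.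
  - have := mG measurableT _ (measurable_itv `[eps ^+ 2, +oo[).
    by rewrite setTI; congr measurable; apply/seteqP; split=> t /=; rewrite in_itv/= andbT.
  - move=> t /= /ltW /le_trans; apply; exact: sqr_enorm_Mhat_sub_Mmean_le.
have le2 := markov_Rintegral e20 G0 iG.
apply: (le_trans (le_trans le1 le2)); rewrite lee_fin -!mulrA.
rewrite ler_wpM2l ?invr_ge0 ?(ltW e20)// eG -mulr_sumr ler_wpM2l//.
apply: (@le_trans _ _ (\sum_(kl : 'I_p * 'I_p) 2 * A * C ^+ 3 * n%:R^-1)).
  apply: ler_sum => kl _.
  exact: (centered_latent_statistic_second_moment_le _ A0 WA KW fW WC).
by rewrite sumr_const -[_ *+ _]mulr_natl !mulrA.
Qed.

End mean_square_bound.

Theorem proposition2 (R : realType) (dT : measure_display)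
    (T : measurableType dT) (P : probability T R)
    (d p : nat) (hd : (1 <= d)%N) (hp : (1 <= p)%N)
    (S : set 'cV[R]_d)
    (s : forall n : nat, 'I_n -> 'cV[R]_d)
    (hsS : forall (n : nat) (i : 'I_n), S (s n i))
    (Omega : 'M[R]_p) (hOmega : Omega \in unitmx)
    (Z : 'I_p -> 'cV[R]_d -> {RV P >-> R})
    (K : 'I_p -> 'cV[R]_d -> R)
    (hindep : independent_processes Z)
    (hgauss : forall k : 'I_p, gaussian_process (Z k))
    (hstat : forall k : 'I_p, stationary_process (Z k) (K k))
    (hmean : forall (k : 'I_p) (x : 'cV[R]_d), ('E_P[Z k x] = 0)%E)
    (hvar : forall (k : 'I_p) (x : 'cV[R]_d), ('V_P[Z k x] = 1)%E)
    (Delta : R) (hDelta : 0 < Delta)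
    (hsep : forall (n : nat) (i j : 'I_n), i != j ->
       Delta <= enorm (s n i - s n j))
    (A alpha : R) (hA : 0 < A) (halpha : 0 < alpha)
    (hK : forall (k : 'I_p) (x : 'cV[R]_d),
       `|K k x| <= A / (1 + enorm x `^ (d%:R + alpha)))
    (f : 'cV[R]_d -> R)
    (hf : forall x : 'cV[R]_d,
       `|f x| <= A / (1 + enorm x `^ (d%:R + alpha))) :
  let X := mixed_field Omega Z in
  cvg_in_probability P
    (fun n t => Mhat X (s n) f t - Mmean P X (s n) f) (fun=> 0).
Proof.
move=> X eps eps0; rewrite {}/X.
have [C sumC] := separated_sum_bound hd hDelta halpha (erefl (d%:R + alpha)).
pose W (x y : 'cV[R]_d) := A / (1 + enorm (x - y) `^ (d%:R + alpha)).
have WA x y : 0 <= W x y <= A.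
  have pw0 : 0 <= enorm (x - y) `^ (d%:R + alpha) := powR_ge0 _ _.
  rewrite divr_ge0 ?(ltW hA) ?addr_ge0//= ler_pdivrMr ?ltr_pwDl//.
  by rewrite ler_peMr ?(ltW hA)// lerDl.
have WC n i : \sum_(j < n) W (s n i) (s n j) <= A * C.
  by rewrite -mulr_sumr ler_wpM2l ?(ltW hA)//; exact/sumC/hsep.
pose c := (eps ^+ 2)^-1 * (mixing_constant Omega *
  (#|{: 'I_p * 'I_p}|%:R * (2 * A * (A * C) ^+ 3))).
apply: (@squeeze_cvge _ _ _ _ (cst 0%E) _ (fun n => (c * n%:R^-1)%:E)).
- apply: nearW => n; rewrite measure_ge0/=.
  under eq_fun do rewrite subr0.
  exact: (Mhat_deviation_le hindep hgauss hstat hmean Omega (ltW hA) WA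
    (fun k a b => hK k (a - b)) (fun a b => hf (a - b)) (WC n)).
- exact: cvg_cst.
- apply/fine_cvgP; split; first exact: nearW.
  rewrite -[X in _ --> X](mulr0 c); apply: cvgMr.
  by rewrite -cvg_shiftS; exact: cvg_harmonic.
Qed.
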